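(* Let $J\subseteq\mathbb{R}$ be an interval and let $f:J\to(0,\infty)$ be a continuous function such that $f^t$ is convex on $J$ for all $0<t<1$. Then for any $a,b\in J$ with $a<b$ and every $t\in(0,1)$, $$f\Big(\frac{a+b}{2}\Big)\le\frac{1}{b-a}\int_a^b f(z)\,dz\le\frac{1}{b-a}\int_a^b\Big(\frac{z-a}{b-a}f^t(a)+\frac{b-z}{b-a}f^t(b)\Big)^{\frac1t}dz\le\frac{f(a)+f(b)}{2}.$$
   Context: $f^t$ denotes the pointwise power $x\mapsto f(x)^t$. *)

(* Defs.v *)
From HB Require Import structures.
From mathcomp Require Export all_boot all_order all_algebra.
From mathcomp Require Export all_classical all_reals all_analysis.
Export Order.TTheory GRing.Theory Num.Theory.
Export numFieldNormedType.Exports.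
#[export] Set Implicit Arguments.
#[export] Unset Strict Implicit.
#[export] Unset Printing Implicit Defensive.
#[global] Open Scope classical_set_scope.
#[global] Open Scope ring_scope.

(* Main.v *)
Require Import Defs.
From mathcomp Require Import ring lra.

(** The middle inequality compares [f] with the power mean of order [t] of its
    end values.  At the point [l * a + (1 - l) * b], convexity of [f ^ t]
    followed by the increasing map [y |-> y ^ (1 / t)] bounds [f] by
    [(l * f a ^ t + (1 - l) * f b ^ t) ^ (1 / t)] ([le_powR_conv]), and since
    [1 / t >= 1] convexity of that same map bounds this power mean by the chord
    [l * f a + (1 - l) * f b] ([powR_conv_le]).  Together, the two bounds make
    [f] itself convex, from a single exponent [t] ([le_conv_of_powR]).

    With the weights of the statement, the power mean at [z] lies above [f] at
    the mirror image [a + b - z], not at [z].  Since the reflection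
    [z |-> a + b - z] preserves the integral over [[a, b]]
    ([Rintegral_reflect]), integrating still gives the second inequality.

    The same reflection replaces an integrand by its symmetrization
    [(G z + G (a + b - z)) / 2] without changing its mean ([mean_symmetrize]),
    which turns the two outer inequalities into pointwise ones:
    the midpoint of [z] and [a + b - z] is [(a + b) / 2], so convexity bounds
    the symmetrization of [f] below by [f ((a + b) / 2)]; and the two chord
    values at [z] and [a + b - z] sum to [f a + f b], so the symmetrization
    of the power mean is at most [(f a + f b) / 2]. *)

(** * Convexity of powers *)

(** The definition of [convex_function] takes its weights in a bundled type of
    elements of the unit interval; here the weight is a bare real, so that it can
    be an expression such as [(z - a) / (b - a)]. *)
Lemma convex_function_le (R : realType) (D : set R) (g : R -> R) (l x y : R) :
  convex_function D g -> D x -> D y -> 0 <= l <= 1 ->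
  g (l * x + (1 - l) * y) <= l * g x + (1 - l) * g y.
Proof.
move=> cvx_g Dx Dy /andP[l0 l1].
by apply: (cvx_g (Itv01 l0 l1)); rewrite inE.
Qed.

Lemma powRVK (R : realType) (t x : R) : 0 < t -> 0 <= x ->
  (x `^ t) `^ t^-1 = x.
Proof. by move=> t0 x0; rewrite -powRrM divff ?gt_eqF// powRr1. Qed.

(** The inequality between the power mean of order [t <= 1] and the arithmetic
    mean: it is convexity of [y |-> y ^ (1 / t)] at the points [x ^ t] and
    [y ^ t]. *)
Lemma powR_conv_le (R : realType) (t l x y : R) :
  0 < t <= 1 -> 0 <= l <= 1 -> 0 <= x -> 0 <= y ->
  (l * x `^ t + (1 - l) * y `^ t) `^ t^-1 <= l * x + (1 - l) * y.
Proof.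
move=> /andP[t0 t1] l01 x0 y0.
rewrite -{2}(powRVK t0 x0) -{2}(powRVK t0 y0).
apply: (convex_function_le (convex_powR _)) => //=.
- by rewrite invf_ge1.
- by rewrite in_itv/= powR_ge0.
- by rewrite in_itv/= powR_ge0.
Qed.

Section convex_power.
Context (R : realType) (D : set R) (f : R -> R) (t : R).
Hypothesis f_ge0 : forall z, D z -> 0 <= f z.
Hypothesis cvx_ft : convex_function D (fun z => f z `^ t).

Lemma le_powR_conv (l x y : R) :
  0 < t -> D x -> D y -> D (l * x + (1 - l) * y) -> 0 <= l <= 1 ->
  f (l * x + (1 - l) * y) <= (l * f x `^ t + (1 - l) * f y `^ t) `^ t^-1.
Proof.
move=> t0 Dx Dy Dz l01; have /andP[l0 l1] := l01.
set z := _ + _ in Dz *.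
rewrite -[leLHS](powRVK t0 (f_ge0 Dz)).
rewrite ge0_ler_powR ?invr_ge0 ?nnegrE ?powR_ge0 ?(ltW t0)//.
  by rewrite addr_ge0// mulr_ge0// ?powR_ge0// subr_ge0.
exact: (convex_function_le cvx_ft).
Qed.

Lemma le_conv_of_powR (l x y : R) :
  0 < t <= 1 -> D x -> D y -> D (l * x + (1 - l) * y) -> 0 <= l <= 1 ->
  f (l * x + (1 - l) * y) <= l * f x + (1 - l) * f y.
Proof.
move=> t01 Dx Dy Dz l01; have /andP[t0 _] := t01.
apply: le_trans (le_powR_conv t0 Dx Dy Dz l01) _.
by apply: powR_conv_le => //; exact: f_ge0.
Qed.

End convex_power.

Lemma continuous_powR (R : realType) (r x : R) : 0 < x ->
  {for x, continuous (fun y : R => y `^ r)}.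
Proof.
move=> x0; apply: differentiable_continuous; apply/derivable1_diffP.
by apply: derivable_powR; rewrite in_itv/= x0.
Qed.

(** * Means over a segment and reflection about its midpoint *)

Section reflection.
Context (R : realType).
Implicit Types (a b : R) (G : R -> R).
Notation mu := (@lebesgue_measure R).

Lemma continuous_reflect a b : continuous (fun x : R => a + b - x).
Proof. by move=> x; apply: cvgB; [exact: cvg_cst|exact: cvg_id]. Qed.

Lemma within_continuous_reflect a b G : {within `[a, b], continuous G} ->
  {within `[a, b], continuous (fun x => G (a + b - x))}.
Proof.
move=> /subspace_continuousP cG; apply/subspace_continuousP => x /= xab.
have rxab y : y \in `[a, b] -> `[a, b]%classic (a + b - y).
  by rewrite /= !in_itv/= => /andP[ay yb]; apply/andP; split; lra.
have cGx := cG _ (rxab x xab).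
move=> W /cGx; rewrite /fmap/= => GW.
have := @continuous_reflect a b x _ GW.
rewrite !nbhs_simpl/=; apply: filterS => y /= Wy yab.
by apply: Wy; exact: rxab.
Qed.

Lemma Rintegral_reflect a b G : a <= b -> {within `[a, b], continuous G} ->
  \int[mu]_(x in `[a, b]) G x = \int[mu]_(x in `[a, b]) G (a + b - x).
Proof.
move=> ab cG.
have D1 : (fun x : R => a + b - x)^`()%classic = cst (-1).
  apply/funext => z; rewrite derive1E deriveB// derive_cst.
  by rewrite derive_id sub0r.
have := @integration_by_substitution_decreasing R (fun x => a + b - x) G a b ab.
have -> : a + b - b = a by ring.
have -> : a + b - a = b by ring.
rewrite /Rintegral => -> //.
- by congr fine; apply: eq_integral => x _; rewrite !fctE D1 opprK mulr1.
- by move=> x y _ _ xy; rewrite ltrD2l ltrN2.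
- by rewrite D1 => x _; exact: cvg_cst.
- by rewrite D1; exact: is_cvg_cst.
- by rewrite D1; exact: is_cvg_cst.
- split => /=.
  + by move=> x _; exact: derivableB.
  + exact/cvg_at_right_filter/continuous_reflect.
  + exact/cvg_at_left_filter/continuous_reflect.
Qed.

Notation mean a b G := ((b - a)^-1 * \int[mu]_(z in `[a, b]) G z).

Lemma integrable_within_continuous a b G : {within `[a, b], continuous G} ->
  mu.-integrable `[a, b] (EFin \o G).
Proof.
move=> cG.
by apply: continuous_compact_integrable => //; exact: segment_compact.
Qed.

Lemma le_mean a b F G : a < b ->
  {within `[a, b], continuous F} -> {within `[a, b], continuous G} ->
  (forall z, z \in `[a, b] -> F z <= G z) ->
  mean a b F <= mean a b G.
Proof.
move=> ab cF cG FG; rewrite ler_pM2l ?invr_gt0 ?subr_gt0//.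
by apply: le_Rintegral => //; exact: integrable_within_continuous.
Qed.

Lemma mean_cst a b c : a < b -> mean a b (cst c) = c.
Proof.
move=> ab; rewrite Rintegral_cst//= lebesgue_measure_itv/= lte_fin ab/=.
by rewrite mulrCA mulVf ?mulr1// subr_eq0 gt_eqF.
Qed.

(** By reflection the integral of [G] equals that of [G (a + b - z)], hence also
    that of their half sum. *)
Lemma mean_symmetrize a b G : a < b -> {within `[a, b], continuous G} ->
  mean a b G = mean a b (fun z => 2^-1 * (G z + G (a + b - z))).
Proof.
move=> ab cG; have crG := within_continuous_reflect cG.
have iG := integrable_within_continuous cG.
have irG := integrable_within_continuous crG.
rewrite RintegralZl//; last first.
  exact/integrable_within_continuous/within_continuousD.
rewrite RintegralD// -(Rintegral_reflect (ltW ab) cG); congr *%R.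
by field.
Qed.

Lemma within_continuous_symmetrize a b G : {within `[a, b], continuous G} ->
  {within `[a, b], continuous (fun z => 2^-1 * (G z + G (a + b - z)))}.
Proof.
move=> cG x; apply: cvgM; first exact: cvg_cst.
by apply: cvgD; [exact: cG|exact: (within_continuous_reflect cG)].
Qed.

Lemma le_mean_symmetrize a b G c : a < b -> {within `[a, b], continuous G} ->
  (forall z, z \in `[a, b] -> c <= 2^-1 * (G z + G (a + b - z))) ->
  c <= mean a b G.
Proof.
move=> ab cG cle; rewrite mean_symmetrize// -[leLHS](mean_cst c ab).
apply: le_mean => //; last exact: within_continuous_symmetrize.
by move=> ?; exact: cst_continuous.
Qed.

Lemma mean_symmetrize_le a b G c : a < b -> {within `[a, b], continuous G} ->
  (forall z, z \in `[a, b] -> 2^-1 * (G z + G (a + b - z)) <= c) ->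
  mean a b G <= c.
Proof.
move=> ab cG cle; rewrite mean_symmetrize// -[leRHS](mean_cst c ab).
apply: le_mean => //; first exact: within_continuous_symmetrize.
by move=> ?; exact: cst_continuous.
Qed.

End reflection.

(** * The refined Hermite-Hadamard inequality *)

Theorem theorem2p1 (R : realType) (J : set R) (f : R -> R)
  (J_itv : is_interval J)
  (f_gt0 : forall x : R, J x -> 0 < f x)
  (f_cont : {within J, continuous f})
  (f_pow_convex : forall t : R, 0 < t < 1 ->
     convex_function J (fun x : R => f x `^ t))
  (a b : R) (Ja : J a) (Jb : J b) (ab : a < b)
  (t : R) (t01 : 0 < t < 1) :
  [/\ f ((a + b) / 2)
        <= (b - a)^-1 * \int[@lebesgue_measure R]_(z in `[a, b]) f z,
      (b - a)^-1 * \int[@lebesgue_measure R]_(z in `[a, b]) f z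
        <= (b - a)^-1 * \int[@lebesgue_measure R]_(z in `[a, b])
             ((z - a) / (b - a) * f a `^ t
              + (b - z) / (b - a) * f b `^ t) `^ t^-1
    & (b - a)^-1 * \int[@lebesgue_measure R]_(z in `[a, b])
             ((z - a) / (b - a) * f a `^ t
              + (b - z) / (b - a) * f b `^ t) `^ t^-1
        <= (f a + f b) / 2].
Proof.
have /andP[t0 t1] := t01; have ba_neq0 : b - a != 0 by rewrite subr_eq0 gt_eqF.
have t01' : 0 < t <= 1 by rewrite t0 ltW.
have subJ z : z \in `[a, b] -> J z.
  by rewrite in_itv/= => zab; exact: (J_itv a b).
have rab z : z \in `[a, b] -> a + b - z \in `[a, b].
  by rewrite !in_itv/= => /andP[az zb]; apply/andP; split; lra.
have f_ge0 z : J z -> 0 <= f z by move=> /f_gt0 /ltW.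
have cf : {within `[a, b], continuous f}.
  by apply: continuous_subspaceW f_cont => z; exact: subJ.
pose w z := (z - a) / (b - a).
have w01 z : z \in `[a, b] -> 0 <= w z <= 1.
  rewrite in_itv/= => /andP[az zb].
  rewrite divr_ge0 ?subr_ge0 ?(ltW ab)//=.
  by rewrite ler_pdivrMr ?subr_gt0// mul1r lerD2r.
have wC z : (b - z) / (b - a) = 1 - w z by rewrite /w; field.
have wr z : w (a + b - z) = 1 - w z by rewrite /w; field.
(* The weight [w z] multiplies [a]: the combination is the reflected point. *)
have convw z : w z * a + (1 - w z) * b = a + b - z by rewrite /w; field.
pose s z := w z * f a `^ t + (1 - w z) * f b `^ t.
pose g z := s z `^ t^-1.
have gE : (fun z => ((z - a) / (b - a) * f a `^ t
              + (b - z) / (b - a) * f b `^ t) `^ t^-1) = g.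
  by apply/funext => z; rewrite wC.
have s_gt0 z : z \in `[a, b] -> 0 < s z.
  move=> /w01 /andP[w0 w1].
  by apply: (@convR_gt0 _ _ _ (Itv01 w0 w1)); exact/powR_gt0/f_gt0.
have cs : continuous s.
  have cw : continuous w.
    move=> z; apply: cvgM; last exact: cvg_cst.
    by apply: cvgB; [exact: cvg_id|exact: cvg_cst].
  move=> z; apply: cvgD; apply: cvgM; try exact: cvg_cst; first exact: cw.
  by apply: cvgB; [exact: cvg_cst|exact: cw].
have cg : {within `[a, b], continuous g}.
  apply: continuous_in_subspaceT => z /set_mem zab.
  apply: (@continuous_comp _ _ _ s (fun y => y `^ t^-1)); first exact: cs.
  exact/continuous_powR/s_gt0.
rewrite gE; split.
- apply: le_mean_symmetrize => // z zab.
  have mE : (a + b) / 2 = 2^-1 * z + (1 - 2^-1) * (a + b - z) by field.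
  have -> : 2^-1 * (f z + f (a + b - z)) =
    2^-1 * f z + (1 - 2^-1) * f (a + b - z) by field.
  rewrite mE; apply: (le_conv_of_powR f_ge0 (f_pow_convex _ t01) t01').
  + exact: subJ.
  + exact/subJ/rab.
  + by rewrite -mE; apply: subJ; rewrite in_itv/=; apply/andP; split; lra.
  + by apply/andP; split; lra.
- rewrite (Rintegral_reflect (ltW ab) cf).
  apply: (le_mean ab (within_continuous_reflect cf) cg) => z zab.
  rewrite -convw; apply: (le_powR_conv f_ge0 (f_pow_convex _ t01) t0) => //.
    by rewrite convw; exact/subJ/rab.
  exact: w01.
- apply: mean_symmetrize_le => // z zab.
  have g_le y : y \in `[a, b] -> g y <= w y * f a + (1 - w y) * f b.
    by move=> /w01 ?; apply: powR_conv_le => //; exact: f_ge0.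
  have -> : (f a + f b) / 2 = 2^-1 * (w z * f a + (1 - w z) * f b +
      (w (a + b - z) * f a + (1 - w (a + b - z)) * f b)).
    by rewrite wr; field.
  by rewrite ler_pM2l ?invr_gt0// lerD// g_le// rab.
Qed.
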